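(* Let $(\mathcal F_n,\int^{x_n})$ be a Rota-Baxter hierarchy over a field $K$, and let $\mathcal G$ be an admissible coefficient domain for $\mathcal F$. Let $1\le i<n$, let $v,w\in K^{n-i}$ with $w\ne0$, and let $g,h\in\mathcal G_1$. Write $v=(v_{i+1},\dots,v_n)^\top$, $w=(w_{i+1},\dots,w_n)^{\top}$, and put $k=\min\{m>i\mid w_m\ne0\}$, $\bar w=w_ke_{k-i}\in K^{n-i}$, $w'=(w_{k+1},\dots,w_n)^\top/w_k\in K^{n-k}$, $$v'=L_{k-i}^{-1}(w')\,v=(v_{i+1},\dots,v_k,\,v_{k+1}-w'_{k+1}v_k,\dots,v_n-w'_nv_k)^{\top}\in K^{n-i},$$ $$\tilde h=h\big[-(v'_k/w_k)\,e_i+e_k/w_k-e_{n+1}/w_k\big],$$ with component vectors $\chi''=\tilde h\{n+1\}$, $\chi'=\tilde h\{i\}$, $\chi=\tilde h\{k\}$. Then on $\mathcal F_n$ one has the identity (summation over $\mu$ implied) $$\int^{x_i}h(x_i)\,L_i(w)^*\int^{x_i}g(x_i)\,L_i(v)^*=L_k^{-1}(w')^*\,\chi''[k\;n{+}1]_\mu\Big(L_i(\bar w)^*\int^{x_i}g(x_i)\,\chi'_\mu\,L_i(v')^*-\int^{x_i}g(x_i)\,\chi'_\mu\,L_i(v'+\bar w)^*\Big)\int^{x_k}\chi_\mu\,L_k(w')^*.$$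
   Context: $K$ is a field of characteristic zero. All $K$-algebras are commutative and unital; all bialgebras are commutative and cocommutative. Rota-Baxter operators have weight zero: a linear operator $P$ with $P(u)P(v)=P(uP(v))+P(P(u)v)$. A Rota-Baxter algebra $(G,P)$ over a ring $R\supseteq\mathbb Q$ ($P$ being $R$-linear) is ordinary if $P$ is injective and $G=R\oplus\operatorname{im}P$ as $R$-modules; its associated evaluation is the projector onto $R$ along $\operatorname{im}P$. Matrices. $\mathcal M(K)$ is the monoid of infinite matrices (indexed by $1,2,\dots$) of the form $I+\tilde M$ with $\tilde M$ having finitely many nonzero rows and columns; $M\in\mathcal M_n(K)=K^{n\times n}$ is identified with $\mathrm{diag}(M,I)$. $\tilde{\mathcal M}_m(K)=\{\mathrm{diag}(I_m,M): M\in\mathcal M(K)\}$. $E_n:=I-e_{nn}$. A scalar $\lambda$ is identified with $\mathrm{diag}(\lambda,1,1,\dots)$; a row $a=(a_1,\dots,a_n)$ is identified with the matrix having first row $a$ and all further rows equal to those of $I$. $T_1(e_1):=I+e_{12}$. For $w=(w_{i+1},\dots,w_n)^{\top}\in K^{n-i}$, $L_i(w):=I+\sum_{k>i}w_ke_{ki}$, so $L_i^{-1}(w)=L_i(-w)$; unit vectors $e_k\in K^{n-i}$ are numbered by position. For $w\in K^{n-k}$ and $i<k$, $L_{k-i}(w)$ acting on $K^{n-i}$ denotes the corresponding $(n-i)\times(n-i)$ matrix. For $M\in\mathcal M(K)$, $M_{\lrcorner n}$ has the same first $n$ rows as $M$ and further rows $e_{n+1},e_{n+2},\dots$. $K$-hierarchy.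 An ascending sequence of $K$-algebras $K=\mathcal F_0\subseteq\mathcal F_1\subseteq\cdots$ with union $\mathcal F$, together with a contravariant monoid action of $\mathcal M(K)$ on $\mathcal F$ by $K$-algebra endomorphisms $M^*$ ($I^*=\mathrm{id}$, $(MN)^*=N^*M^*$) that is straight ($M^*f=M_{\lrcorner n}^*f$ for $f\in\mathcal F_n$) and satisfies $M^*(\mathcal F_n)\subseteq\mathcal F_n$ for $M\in\mathcal M_n(K)$ and $E_n^*(\mathcal F_n)\subseteq\mathcal F_{n-1}$. Rota-Baxter hierarchy. A $K$-hierarchy with commuting Rota-Baxter operators $\int^{x_n}:\mathcal F\to\mathcal F$ ($n\ge1$) such that: (a) for $n\le m$, $\int^{x_n}\mathcal F_m\subseteq\mathcal F_m$ and $\int^{x_n}M^*=M^*\int^{x_n}$ for all $M\in\tilde{\mathcal M}_m(K)$; (b) every $(\mathcal F_n,\int^{x_n})$ is an ordinary Rota-Baxter algebra over $\mathcal F_{n-1}$ with evaluation $E_n^*$; (c) $\tau^*\int^{x_i}=\int^{x_j}\tau^*$ for the transposition matrix $\tau=(i\;j)$; (d) for $\lambda\in K\setminus\{0\}$ and $v=(0,v')\in K\oplus K^{n-2}$: $\int^{x_1}\lambda^*=\lambda^{-1}\lambda^*\int^{x_1}$; $\int^{x_1}T_1(e_1)^*=(1-E_1^* )T_1(e_1)^*\int^{x_1}$; and $\int^{x_1}L_1(e_1+v)^*\int^{x_1}=L_2^{-1}(v')^*\,[L_1(e_1)^*,\int^{x_1}]\,\int^{x_2}L_2(v')^*$, where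 $[S,T]=ST-TS$. A Rota-Baxter subhierarchy consists of subalgebras $\mathcal G_n\subseteq\mathcal F_n$ forming a Rota-Baxter hierarchy under the restricted operators and the restricted matrix action. Scaled Rota-Baxter bialgebra. Let $(B,\Delta,\epsilon)$ be a $K$-bialgebra with product $\nabla$, unit $1$; put $\mathsf e:=1\circ\epsilon$ and $f\oplus g:=\nabla(f\otimes g)\Delta$ for linear endomorphisms. $(B,\Delta,\epsilon,\int)$ is a Rota-Baxter bialgebra if $(B,\int)$ is an ordinary Rota-Baxter algebra over $K$, $\mathsf e$ is the projector onto $K$ along $\operatorname{im}\int$, and $\Delta\int=(\int\otimes\mathrm{id})\Delta+(\mathsf e\otimes\mathrm{id})\Delta\int$. It is scaled if there is also a scaling $\lambda\mapsto\lambda^*$, i.e. a monoid homomorphism from $(K\setminus\{0\},\cdot)$ to bialgebra endomorphisms of $B$ such that, with $0^*:=\mathsf e$, $\lambda\mapsto\lambda^*$ is a semiring homomorphism $(K,+,\cdot)\to(\text{bialgebra endomorphisms},\oplus,\circ)$, and $\int\lambda^*=\lambda^{-1}\lambda^*\int$ for $\lambda\ne0$. Its induced Rota-Baxter hierarchy $\mathfrak H(B)$ has components $B_n=B^{\otimes n}$ (embedded in $B_{n+1}$ by $f\mapsto f\otimes1$), operators $\int^{x_n}=\mathrm{id}^{\otimes(n-1)}\otimes\int$, and matrix action $M^*(f_1\otimes\cdots\otimes f_n)=(M_{1\bullet}^*f_1)\cdots(M_{n\bullet}^*f_n)$, where $a^*:=(a_1^*\otimes\cdots\otimes a_n^* )\Delta^n:B\to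 B_n$ for a row $a$, and $\Delta^n$ is the iterated coproduct. Admissible coefficient domain. A Rota-Baxter hierarchy is separated if it is of the form $\mathfrak H(B)$ for a scaled Rota-Baxter bialgebra $B$. An admissible coefficient domain for $\mathcal F$ is a separated Rota-Baxter subhierarchy $\mathcal G=\mathfrak H(B)\le\mathcal F$; so $\mathcal G_1=B$, $\mathcal G_n=B^{\otimes n}$. Notation. $f[M]:=M^*(f)$; $f[i\;j]:=f[(i\;j)]$ for transpositions, and $f[a]$ likewise for a row $a$. For $f\in\mathcal G_1$, $f(x_i):=(1\;i)^*f\in\mathcal G_{(i)}$, where $\mathcal G_{(i)}=(1\;i)^*\mathcal G_1$. Elements $f\in\mathcal F$ also denote the multiplication operators $u\mapsto fu$, and juxtaposition in operator expressions is composition. Tensor expansion and component sequences. Fix an ordered $K$-basis $(b_i)$ of $\mathcal G_1$ and use the graded lexicographic ordering on the induced basis of $\mathcal G_m=\mathcal G_1^{\otimes m}$. Every $g\in\mathcal G_m$ is expanded as $g=\sum_{\mu=1}^r g_{1,\mu}\otimes\cdots\otimes g_{m,\mu}$, where each summand has the form $\lambda_\mu\,b_{i_1(\mu)}\otimes\cdots\otimes b_{i_m(\mu)}$ with $\lambda_\mu\in K$, and one chooses $g_{1,\mu}=\lambda_\mu b_{i_1(\mu)}$ and $g_{j,\mu}=b_{i_j(\mu)}$ for $j>1$. The component sequences are $g\{j\}:=(1\;j)^*(g_{j,1},\dots,g_{j,r})\in\mathcal G_{(j)}^r$ for $j=1,\dots,m$. (Here $\tilde h\in\mathcal G_{n+1}$.)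 For a sequence $\gamma$, $\gamma[M]$ is taken componentwise. Summation over repeated Greek indices is implied.
   Formalization: The right-hand side carries an extra factor 1/w_k (the printed identity fails for polynomials with w_k=2); in the expansion of h~ the scalar λ_μ is placed in slot i rather than slot 1, and slots other than i, k, n+1 contain 1 instead of basis elements. *)

(* Defs.v *)
From HB Require Import structures.
From mathcomp Require Import all_boot all_order all_algebra.
From mathcomp Require Import boolp classical_sets fsbigop.

Set Implicit Arguments.
Unset Strict Implicit.
Unset Printing Implicit Defensive.

Import GRing.Theory.
Local Open Scope ring_scope.
Local Open Scope quotient_scope.
Local Open Scope classical_set_scope.

(* All indices start at 0: the variable x_{n+1}, the matrix row n+1 and the   *)
(* operator int^{x_{n+1}} of the usual numbering carry the index n here.      *)

(******************************************************************************)
(*                  Tensor powers of a vector space                           *)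
(******************************************************************************)

Section TensorPower.
Variables (K : fieldType) (V : lmodType K) (n : nat).
Implicit Types u : {ffun 'I_n -> V}.

Definition upd u (j : 'I_n) (x : V) : {ffun 'I_n -> V} :=
  [ffun i => if i == j then x else u i].

Definition multilinear (W : lmodType K) (phi : {ffun 'I_n -> V} -> W) : Prop :=
  forall u j (c : K) (x y : V),
    phi (upd u j (c *: x + y)) = c *: phi (upd u j x) + phi (upd u j y).

(* A finite formal sum of c * (u_1 (x) ... (x) u_n). *)
Local Notation formal_sum := (seq (K * {ffun 'I_n -> V})).

Definition feval (W : lmodType K) (phi : {ffun 'I_n -> V} -> W)
  (s : formal_sum) : W := \sum_(p <- s) p.1 *: phi p.2.

(* Formal sums are identified when no multilinear map into any vector space   *)
(* tells them apart; this is the least identification making the elementary   *)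
(* tensors multilinear, and gives the universal property by construction      *)
(* (tlift_pure, tlift_unique below).                                          *)
Definition feq (s t : formal_sum) : bool :=
  `[< forall (W : lmodType K) (phi : {ffun 'I_n -> V} -> W),
        multilinear phi -> feval phi s = feval phi t >].

Lemma feq_refl : reflexive feq.
Proof. by move=> s; apply/asboolP. Qed.

Lemma feq_sym : symmetric feq.
Proof.
by move=> s t; apply/asboolP/asboolP => E W phi m; rewrite E.
Qed.

Lemma feq_trans : transitive feq.
Proof.
move=> t s r /asboolP E1 /asboolP E2; apply/asboolP => W phi m.
by rewrite E1 // E2.
Qed.

Canonical feq_equiv := EquivRel feq feq_refl feq_sym feq_trans.

Definition tpow := {eq_quot feq}.
HB.instance Definition _ := EqQuotient.on tpow.
HB.instance Definition _ := Choice.on tpow.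

Definition tlift (W : lmodType K) (phi : {ffun 'I_n -> V} -> W) (t : tpow) : W :=
  feval phi (repr t).

Lemma tlift_pi (W : lmodType K) (phi : {ffun 'I_n -> V} -> W) (s : formal_sum) :
  multilinear phi -> tlift phi (\pi_tpow s) = feval phi s.
Proof.
move=> m; rewrite /tlift.
have /eqmodP /asboolP -> // : repr (\pi_tpow s) = s %[mod tpow] by rewrite reprK.
Qed.

Lemma tpow_eqP (s t : tpow) :
  (forall (W : lmodType K) (phi : {ffun 'I_n -> V} -> W),
     multilinear phi -> tlift phi s = tlift phi t) <-> s = t.
Proof.
split=> [E|-> //]; rewrite -[s]reprK -[t]reprK; apply/eqmodP/asboolP => W phi m.
exact: E.
Qed.

Definition tzero : tpow := \pi_tpow [::].
Definition tadd (s t : tpow) : tpow := \pi_tpow (repr s ++ repr t).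
Definition tscale (c : K) (t : tpow) : tpow :=
  \pi_tpow [seq (c * p.1, p.2) | p <- repr t].
Definition topp (t : tpow) : tpow := tscale (-1) t.

Section Eval.
Variables (W : lmodType K) (phi : {ffun 'I_n -> V} -> W).
Hypothesis mphi : multilinear phi.

Lemma tlift0 : tlift phi tzero = 0.
Proof. by rewrite tlift_pi // /feval big_nil. Qed.

Lemma tliftD s t : tlift phi (tadd s t) = tlift phi s + tlift phi t.
Proof. by rewrite tlift_pi // /feval big_cat. Qed.

Lemma tliftZ c t : tlift phi (tscale c t) = c *: tlift phi t.
Proof.
rewrite tlift_pi // /feval big_map scaler_sumr.
by apply: eq_bigr => p _; rewrite scalerA.
Qed.

Lemma tliftN t : tlift phi (topp t) = - tlift phi t.
Proof. by rewrite tliftZ scaleN1r. Qed.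
End Eval.

Lemma taddA : associative tadd.
Proof.
by move=> r s t; apply/tpow_eqP => W phi m; rewrite !tliftD // addrA.
Qed.

Lemma taddC : commutative tadd.
Proof. by move=> s t; apply/tpow_eqP => W phi m; rewrite !tliftD // addrC. Qed.

Lemma tadd0 : left_id tzero tadd.
Proof.
by move=> t; apply/tpow_eqP => W phi m; rewrite tliftD // tlift0 // add0r.
Qed.

Lemma taddN : left_inverse tzero topp tadd.
Proof.
move=> t; apply/tpow_eqP => W phi m.
by rewrite tliftD // tlift0 // tliftN // addNr.
Qed.

HB.instance Definition _ := GRing.isZmodule.Build tpow taddA taddC tadd0 taddN.

Lemma tscaleA a c t : tscale a (tscale c t) = tscale (a * c) t.
Proof. by apply/tpow_eqP => W phi m; rewrite !tliftZ // scalerA. Qed.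

Lemma tscale1 : left_id 1 tscale.
Proof. by move=> t; apply/tpow_eqP => W phi m; rewrite tliftZ // scale1r. Qed.

Lemma tscaleDr : right_distributive tscale +%R.
Proof.
move=> c s t; apply/tpow_eqP => W phi m.
by rewrite tliftZ // !tliftD // !tliftZ // scalerDr.
Qed.

Lemma tscaleDl t : {morph tscale^~ t : a c / a + c}.
Proof.
move=> a c; apply/tpow_eqP => W phi m.
by rewrite tliftD // !tliftZ // scalerDl.
Qed.

HB.instance Definition _ := GRing.Zmodule_isLmodule.Build K tpow
  tscaleA tscale1 tscaleDr tscaleDl.

(* u_1 (x) ... (x) u_n *)
Definition tpure u : tpow := \pi_tpow [:: (1, u)].

Lemma tlift_pure (W : lmodType K) (phi : {ffun 'I_n -> V} -> W) u :
  multilinear phi -> tlift phi (tpure u) = phi u.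
Proof. by move=> m; rewrite tlift_pi // /feval big_seq1 scale1r. Qed.

Lemma tlift_linear (W : lmodType K) (phi : {ffun 'I_n -> V} -> W) :
  multilinear phi -> linear (tlift phi).
Proof. by move=> m c s t; rewrite tliftD // tliftZ. Qed.

Lemma tpure_multilinear : multilinear tpure.
Proof.
move=> u j c x y; apply/tpow_eqP => W phi m.
by rewrite tliftD // tliftZ // !tlift_pure.
Qed.

Lemma tpowE (t : tpow) : t = \sum_(p <- repr t) p.1 *: tpure p.2.
Proof.
apply/tpow_eqP => W phi m; rewrite {1}/tlift /feval.
elim: (repr t) => [|p s IHs]; first by rewrite !big_nil tlift0.
by rewrite !big_cons tliftD // tliftZ // tlift_pure // IHs.
Qed.

Lemma tlift_unique (W : lmodType K) (phi : {ffun 'I_n -> V} -> W)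
    (psi : {linear tpow -> W}) :
  (forall u, psi (tpure u) = phi u) -> tlift phi =1 psi.
Proof.
move=> E t; rewrite {2}(tpowE t) linear_sum /tlift /feval.
by apply: eq_bigr => p _; rewrite linearZ /= E.
Qed.

End TensorPower.

Section TensorMaps.
Variables (K : fieldType) (V : lmodType K).

Definition tpure2 (x y : V) : tpow V 2 :=
  tpure [ffun j : 'I_2 => if j == ord0 then x else y].

(* The map V (x) V -> W induced by a bilinear phi. *)
Definition tlift2 (W : lmodType K) (phi : V -> V -> W) : tpow V 2 -> W :=
  tlift (fun u => phi (u ord0) (u ord_max)).

(* f_1 (x) ... (x) f_n for linear maps f_j *)
Definition tmap n (f : 'I_n -> V -> V) : tpow V n -> tpow V n :=
  tlift (fun u => tpure [ffun j => f j (u j)]).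

(* t |-> t (x) x *)
Definition tsnoc n (t : tpow V n) (x : V) : tpow V n.+1 :=
  tlift (fun u => tpure [ffun j : 'I_n.+1 =>
                    if unlift ord_max j is Some l then u l else x]) t.

(* t |-> x (x) t *)
Definition tcons n (x : V) (t : tpow V n) : tpow V n.+1 :=
  tlift (fun u => tpure [ffun j : 'I_n.+1 =>
                    if unlift ord0 j is Some l then u l else x]) t.

End TensorMaps.

Section TensorAlgebra.
Variables (K : fieldType) (B : comAlgType K) (n : nat).

Definition tone : tpow B n := tpure [ffun=> 1].

Definition tmul (s t : tpow B n) : tpow B n :=
  tlift (fun u => tlift (fun v => tpure [ffun j => u j * v j]) t) s.

End TensorAlgebra.

(******************************************************************************)
(*                       Ordinary Rota-Baxter algebras                        *)
(******************************************************************************)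

(* P is an ordinary Rota-Baxter operator of weight 0 on the subalgebra S of   *)
(* A, over the subalgebra R of S, with associated evaluation ev.              *)
Record ordinary_rb (K : fieldType) (A : comAlgType K) (R S : set A)
    (P ev : A -> A) : Prop := OrdinaryRB {
  orb_stable : forall u, S u -> S (P u);
  orb_add : forall u v, S u -> S v -> P (u + v) = P u + P v;
  orb_scale : forall c u, R c -> S u -> P (c * u) = c * P u;
  orb_rb : forall u v, S u -> S v -> P u * P v = P (u * P v) + P (P u * v);
  orb_inj : forall u v, S u -> S v -> P u = P v -> u = v;
  orb_sum : forall f, S f -> exists c u, [/\ R c, S u & f = c + P u];
  orb_direct : forall c u, R c -> S u -> c = P u -> c = 0;
  orb_ev : forall c u, R c -> S u -> ev (c + P u) = c
}.

Definition scalars (K : fieldType) (A : comAlgType K) : set A :=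
  range (fun c : K => c%:A).

(******************************************************************************)
(*                    The matrix monoid M(K)                                  *)
(******************************************************************************)

Section Matrices.
Variable K : fieldType.

Definition delta (r c : nat) : K := (r == c)%:R.

(* f = diag(A, I) with A of size N *)
Definition of_size (N : nat) (f : nat -> nat -> K) : Prop :=
  forall r c, (N <= r)%N || (N <= c)%N -> f r c = delta r c.

Record imx := Imx {
  imx_val :> nat -> nat -> K;
  imx_fin : exists N, of_size N imx_val
}.

(* The matrix diag(A, I) with A the leading N x N block of f. *)
Definition block_fun (N : nat) (f : nat -> nat -> K) (r c : nat) : K :=
  if (r < N)%N && (c < N)%N then f r c else delta r c.

Fact block_fin N f : exists N', of_size N' (block_fun N f).
Proof.
exists N => r c; rewrite /block_fun.
by case: (ltnP r N) => //= _; case: ltnP.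
Qed.

Definition imx_block N f : imx := Imx (block_fin N f).

Definition imx1 : imx := imx_block 0 delta.

Definition mul_fun (M N : imx) (r c : nat) : K :=
  \sum_(l \in [set: nat]) M r l * N l c.

Fact mul_fin (M N : imx) : exists m, of_size m (mul_fun M N).
Proof.
have [m1 f1] := imx_fin M; have [m2 f2] := imx_fin N.
exists (maxn m1 m2) => r c; rewrite !geq_max => le_m; rewrite /mul_fun.
have sum1 (x : nat) (F : nat -> K) : (forall l, l != x -> F l = 0) ->
    \sum_(l \in [set: nat]) F l = F x.
  move=> F0; rewrite -(fsbig_set1 (@GRing.add K) x F); apply/esym/fsbig_widen => //.
  by move=> l [_ /= /eqP /F0].
case/orP: le_m => /andP[le1 le2].
- rewrite (sum1 r) => [|l].
    by rewrite f1 ?le1 // /delta eqxx mul1r f2 ?le2.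
  by rewrite eq_sym => /negPf neq; rewrite f1 ?le1 // /delta neq mul0r.
- rewrite (sum1 c) => [|l /negPf neq].
    by rewrite f2 ?le2 ?orbT // /delta eqxx mulr1 f1 ?le1 ?orbT.
  by rewrite f2 ?le2 ?orbT // /delta neq mulr0.
Qed.

Definition imx_mul (M N : imx) : imx := Imx (mul_fin M N).

(* The first n rows of M, followed by rows of the identity. *)
Definition cut_fun (n : nat) (M : imx) (r c : nat) : K :=
  if (r < n)%N then M r c else delta r c.

Fact cut_fin n M : exists N, of_size N (cut_fun n M).
Proof.
have [m f] := imx_fin M; exists m => r c le_m.
by rewrite /cut_fun; case: ifP => // _; rewrite f.
Qed.

Definition imx_cut n M : imx := Imx (cut_fin n M).

(* diag(I_m, M) *)
Definition shift_fun (m : nat) (M : imx) (r c : nat) : K :=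
  if (m <= r)%N && (m <= c)%N then M (r - m)%N (c - m)%N else delta r c.

Fact shift_fin m M : exists N, of_size N (shift_fun m M).
Proof.
have [p f] := imx_fin M; exists (m + p)%N => r c le_p; rewrite /shift_fun.
case: ifP => // /andP[le_r le_c]; rewrite f.
  by rewrite /delta -(eqn_add2l m) !subnKC.
by case/orP: le_p => le_p; apply/orP; [left|right]; rewrite leq_subRL.
Qed.

Definition imx_shift m M : imx := Imx (shift_fin m M).

(* E_n = I - e_nn *)
Definition imx_E (n : nat) : imx :=
  imx_block n.+1 (fun r c => delta r c - ((r == n) && (c == n))%:R).

(* The scalar lambda as diag(lambda, 1, 1, ...). *)
Definition imx_scal (lambda : K) : imx := imx_block 1 (fun _ _ => lambda).

(* The row a as the matrix with first row a, continued by rows of I. *)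
Definition imx_row (m : nat) (a : 'rV[K]_m.+1) : imx :=
  imx_block m.+1 (fun r c => if r == 0%N then a ord0 (inord c) else delta r c).

(* The transposition matrix (i j). *)
Definition imx_transp (i j : nat) : imx :=
  imx_block (maxn i j).+1
    (fun r c => delta (if r == i then j else if r == j then i else r) c).

(* T_1(e_1) = I + e_12 *)
Definition imx_T1 : imx :=
  imx_block 2 (fun r c => delta r c + ((r == 0%N) && (c == 1%N))%:R).

(* The entry w_m of a column w = (w_{i+1}, ..., w_{i+d})^T whose entries are  *)
(* labelled by i+1, ..., i+d; it is 0 for other labels m.                     *)
Definition entry (i d : nat) (w : 'cV[K]_d) (m : nat) : K :=
  if (i < m)%N then
    if insub (m - i.+1)%N is Some p then w p ord0 else 0
  else 0.

(* L_i(w) = I + sum_(m > i) w_m e_mi *)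
Definition imx_L (i d : nat) (w : 'cV[K]_d) : imx :=
  imx_block (i.+1 + d)
    (fun r c => delta r c + (if c == i then entry i w r else 0)).

(* The d x d matrix A for which M = diag(A, I), if there is one. *)
Definition trunc_mx (d : nat) (M : imx) : 'M[K]_d := \matrix_(r, c) M r c.

(* k is the least label of a nonzero entry of w. *)
Definition is_pivot (i d : nat) (w : 'cV[K]_d) (k : nat) : Prop :=
  [/\ (i < k)%N, entry i w k != 0 & forall m, (m < k)%N -> entry i w m = 0].

End Matrices.

(******************************************************************************)
(*                    Rota-Baxter hierarchies                                 *)
(******************************************************************************)

Section Hierarchies.
Variables (K : fieldType) (A : comAlgType K).
Variables (F : nat -> set A) (act : imx K -> A -> A).

Local Notation U := (\bigcup_n F n).

(* F 0 <= F 1 <= ... is a K-hierarchy; act M is M^*, acting on the union. *)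
Record is_hierarchy : Prop := IsHierarchy {
  hier_subalg : forall n, GRing.subalg_closed [in F n];
  hier_base : F 0 = @scalars K A;
  hier_ascending : forall n, F n `<=` F n.+1;
  hier_act_stable : forall M f, U f -> U (act M f);
  hier_act_linear : forall M c f g, U f -> U g ->
    act M (c *: f + g) = c *: act M f + act M g;
  hier_act_mul : forall M f g, U f -> U g -> act M (f * g) = act M f * act M g;
  hier_act_unit : forall M, act M 1 = 1;
  hier_act1 : forall f, U f -> act (imx1 K) f = f;
  hier_actM : forall M N f, U f -> act (imx_mul M N) f = act N (act M f);
  hier_straight : forall n M f, F n f -> act M f = act (imx_cut n M) f;
  hier_act_comp : forall n (M : imx K) f, of_size n M -> F n f -> F n (act M f);
  hier_act_E : forall n f, F n.+1 f -> F n (act (imx_E K n) f)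
}.

Variable int : nat -> A -> A.

Record is_rb_hierarchy : Prop := IsRBHierarchy {
  rbh_hier : is_hierarchy;
  rbh_stable : forall n f, U f -> U (int n f);
  rbh_linear : forall n c f g, U f -> U g ->
    int n (c *: f + g) = c *: int n f + int n g;
  rbh_rb : forall n f g, U f -> U g ->
    int n f * int n g = int n (f * int n g) + int n (int n f * g);
  rbh_comm : forall m n f, U f -> int m (int n f) = int n (int m f);
  rbh_comp : forall n m f, (n < m)%N -> F m f -> F m (int n f);
  rbh_shift : forall n m M f, (n < m)%N -> U f ->
    int n (act (imx_shift m M) f) = act (imx_shift m M) (int n f);
  rbh_ordinary : forall n,
    ordinary_rb (F n) (F n.+1) (int n) (act (imx_E K n));
  rbh_transp : forall i j f, U f ->
    act (imx_transp K i j) (int i f) = int j (act (imx_transp K i j) f);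
  rbh_scal : forall (l : K) f, l != 0 -> U f ->
    int 0%N (act (imx_scal l) f) = l^-1 *: act (imx_scal l) (int 0%N f);
  rbh_T1 : forall f, U f ->
    int 0%N (act (imx_T1 K) f) =
    act (imx_T1 K) (int 0%N f)
      - act (imx_E K 0) (act (imx_T1 K) (int 0%N f));
  rbh_L1 : forall d (v' : 'cV[K]_d) f, U f ->
    let e1 : 'cV[K]_(1 + d) := delta_mx ord0 ord0 in
    let v : 'cV[K]_(1 + d) := col_mx 0 v' in
    let y := int 1%N (act (imx_L 1 v') f) in
    int 0%N (act (imx_L 0 (e1 + v)) (int 0%N f)) =
    act (imx_L 1 (- v'))
      (act (imx_L 0 e1) (int 0%N y) - int 0%N (act (imx_L 0 e1) y))
}.

End Hierarchies.

Record rbHierarchy (K : fieldType) := RBHierarchy {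
  rbh_alg :> comAlgType K;
  hcomp : nat -> set rbh_alg;
  hact : imx K -> rbh_alg -> rbh_alg;
  hint : nat -> rbh_alg -> rbh_alg;
  rbh_union : \bigcup_n hcomp n = setT;
  rbhP : is_rb_hierarchy hcomp hact hint
}.
Arguments hcomp {K} _ _.
Arguments hact {K} _ _ _.
Arguments hint {K} _ _ _.

Definition is_rb_subhierarchy (K : fieldType) (F : rbHierarchy K)
    (G : nat -> set F) : Prop :=
  (forall n, G n `<=` hcomp F n) /\ is_rb_hierarchy G (hact F) (hint F).

(******************************************************************************)
(*                    Scaled Rota-Baxter bialgebras                           *)
(******************************************************************************)

Section Bialgebras.
Variables (K : fieldType) (B : comAlgType K).
Variables (cop : B -> tpow B 2) (eps : B -> K).

(* A commutative and cocommutative bialgebra. *)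
Record is_bialgebra : Prop := IsBialgebra {
  cop_linear : linear cop;
  cop_unit : cop 1 = tone B 2;
  cop_mul : forall x y, cop (x * y) = tmul (cop x) (cop y);
  eps_linear : linear (eps : B -> K^o);
  eps_unit : eps 1 = 1;
  eps_mul : forall x y, eps (x * y) = eps x * eps y;
  cop_assoc : forall x, tlift2 (fun y z => tsnoc (cop y) z) (cop x) =
                        tlift2 (fun y z => tcons y (cop z)) (cop x);
  cop_counit_l : forall x, tlift2 (fun y z => eps y *: z) (cop x) = x;
  cop_counit_r : forall x, tlift2 (fun y z => eps z *: y) (cop x) = x;
  cop_cocomm : forall x, tlift2 (fun y z => tpure2 z y) (cop x) = cop x
}.

Record is_bialg_endo (f : B -> B) : Prop := IsBialgEndo {
  endo_linear : linear f;
  endo_unit : f 1 = 1;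
  endo_mul : forall x y, f (x * y) = f x * f y;
  endo_cop : forall x, cop (f x) = tmap (fun=> f) (cop x);
  endo_eps : forall x, eps (f x) = eps x
}.

(* e = 1 o eps *)
Definition unit_counit (x : B) : B := (eps x)%:A.

(* f (+) g *)
Definition conv (f g : B -> B) (x : B) : B :=
  tlift2 (fun y z => f y * g z) (cop x).

Record is_rb_bialgebra (P : B -> B) : Prop := IsRBBialgebra {
  rbb_bialg : is_bialgebra;
  rbb_ordinary : ordinary_rb (@scalars K B) setT P unit_counit;
  rbb_cop : forall x,
    cop (P x) = tlift2 (fun y z => tpure2 (P y) z) (cop x)
              + tlift2 (fun y z => tpure2 (unit_counit y) z) (cop (P x))
}.

Record is_scaling (P : B -> B) (scal : K -> B -> B) : Prop := IsScaling {
  scal_endo : forall l, is_bialg_endo (scal l);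
  scal0 : scal 0 =1 unit_counit;
  scal1 : scal 1 =1 id;
  scalM : forall l m, scal (l * m) =1 scal l \o scal m;
  scalD : forall l m, scal (l + m) =1 conv (scal l) (scal m);
  scal_int : forall l x, l != 0 -> P (scal l x) = l^-1 *: scal l (P x)
}.

(* The iterated coproduct, with values in the n-th tensor power. *)
Fixpoint iter_cop (n : nat) : B -> tpow B n :=
  match n with
  | 0 => fun x => eps x *: tone B 0
  | m.+1 => fun x => tlift2 (fun y z => tsnoc (iter_cop m y) z) (cop x)
  end.

(* a^* = (a_1^* (x) ... (x) a_n^* ) o Delta^n for a row a *)
Definition row_act (scal : K -> B -> B) (n : nat) (a : nat -> K) (x : B) :
  tpow B n := tmap (fun j : 'I_n => scal (a j)) (iter_cop n x).

End Bialgebras.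

Record scaledRBBialgebra (K : fieldType) := ScaledRBBialgebra {
  srb_alg :> comAlgType K;
  cop : srb_alg -> tpow srb_alg 2;
  eps : srb_alg -> K;
  srb_int : srb_alg -> srb_alg;
  scal : K -> srb_alg -> srb_alg;
  srb_rbb : is_rb_bialgebra cop eps srb_int;
  srb_scaling : is_scaling cop eps srb_int scal
}.

(******************************************************************************)
(*                  Admissible coefficient domains                            *)
(******************************************************************************)

(* The maps emb n identify the tensor powers of B with subalgebras of A in    *)
(* such a way that the operations act and int of A become those of the        *)
(* induced hierarchy of B.                                                    *)
Record is_induced (K : fieldType) (B : scaledRBBialgebra K) (A : comAlgType K)
    (act : imx K -> A -> A) (int : nat -> A -> A)
    (emb : forall n, tpow B n -> A) : Prop := IsInduced {
  ind_linear : forall n, linear (@emb n);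
  ind_inj : forall n, injective (@emb n);
  ind_unit : forall n, emb n (tone B n) = 1;
  ind_mul : forall n s t, emb n (tmul s t) = emb n s * emb n t;
  ind_snoc : forall n t, emb n.+1 (tsnoc t 1) = emb n t;
  ind_int : forall n (j : 'I_n) u,
    int j (emb n (tpure u)) = emb n (tpure (upd u j (srb_int (u j))));
  ind_act : forall n N (M : imx K) u, (n <= N)%N -> of_size N M ->
    act M (emb n (tpure u)) =
    \prod_(r < n) emb N (row_act (@cop K B) (@eps K B) (@scal K B) N (M r) (u r))
}.

Record coefDomain (K : fieldType) (F : rbHierarchy K) := CoefDomain {
  cd_bialg :> scaledRBBialgebra K;
  cd_emb : forall n, tpow cd_bialg n -> F;
  cd_induced : is_induced (hact F) (hint F) cd_emb;
  cd_sub : is_rb_subhierarchy (fun n => range (@cd_emb n))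
}.

Section Expansions.
Variables (K : fieldType) (F : rbHierarchy K) (G : coefDomain F).

(* An element of B, viewed in F via B = G_1. *)
Definition embed (x : G) : F := @cd_emb K F G 1 (tpure [ffun=> x]).

(* f(x_i) := (1 i)^* f *)
Definition at_var (x : G) (i : nat) : F := hact F (imx_transp K 0 i) (embed x).

Definition is_basis (I : eqType) (b : I -> G) : Prop :=
  (forall (s : seq I) (c : I -> K), uniq s ->
     \sum_(l <- s) c l *: b l = 0 -> {in s, forall l, c l = 0}) /\
  (forall x : G, exists (s : seq I) (c : I -> K), x = \sum_(l <- s) c l *: b l).

(* A tensor expansion of y in G_m, with respect to a basis b, of an element   *)
(* depending only on the variables in the increasing list s of slots. It has  *)
(* one summand                                                                *)
(*    lambda_mu b_{i_1(mu)} (x) ... (x) b_{i_m(mu)}                           *)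
(* for each mu, where lambda_mu is absorbed by the first slot in s, and the   *)
(* slots outside s are filled with 1 instead of a basis element. For          *)
(* s = iota 0 m this is an expansion with respect to the basis of G_m that b  *)
(* induces. The summands may come in any order.                               *)
Record expansion (I : eqType) (b : I -> G) (m : nat) (s : seq nat) (y : F) :=
  Expansion {
    ex_size : nat;
    ex_coef : 'I_ex_size -> K;
    ex_idx : 'I_ex_size -> nat -> I;
    ex_factor (j : nat) (mu : 'I_ex_size) : G :=
      if j \in s then
        (if j == head 0%N s then ex_coef mu else 1) *: b (ex_idx mu j)
      else 1;
    ex_coef_neq0 : forall mu, ex_coef mu != 0;
    ex_idx_inj : injective (fun mu => [seq ex_idx mu j | j <- s]);
    ex_eq : y = @cd_emb K F G m
                  (\sum_(mu < ex_size) tpure [ffun j : 'I_m => ex_factor j mu])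
  }.

(* The component sequence y{j} = (1 j)^* (g_{j,1}, ..., g_{j,r}). *)
Definition component (I : eqType) (b : I -> G) m s y
    (e : @expansion I b m s y) (j : nat) (mu : 'I_(ex_size e)) : F :=
  at_var (ex_factor (e := e) j mu) j.

End Expansions.

(* Main.v *)
From HB Require Import structures.
Require Import Defs.
From mathcomp Require Import all_boot all_order all_algebra.
From mathcomp Require Import boolp classical_sets fsbigop.
From mathcomp Require Import ring zify.

Set Implicit Arguments.
Unset Strict Implicit.
Unset Printing Implicit Defensive.
Import GRing.Theory.
Local Open Scope ring_scope.
Local Open Scope classical_set_scope.

(** Think of the elements of F as functions of x_0, x_1, ..., of [hact F M] as
    the substitution x := M x, and of [hint F l] as the integral from 0 to x_l.
    The left-hand side is a double integral over 0 <= t <= s <= x_i in which the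
    argument x_k of f becomes u = x_k + w_k s + v_k t.  Exchanging the two
    integrals and taking u instead of s as inner variable, at the price of the
    Jacobian 1 / w_k, turns the inner integral into the difference of one
    antiderivative in x_k at the end points s = x_i and s = t; these are the two
    terms on the right.  The coefficient h(s) = h((u - x_k - v_k t) / w_k) is
    distributed over t, u and x_k by its tensor expansion.

    In a hierarchy the variables s, t and u are not available, and the argument
    is carried out by operators.

    - Conjugation by L_k(w') eliminates the entries of w beyond w_k, because
      L_i(w) L_k(w') = L_k(w') S with S = I + w_k e_{ki}, and replaces v by v'.

    - [pull_coefficient] moves h into the inner integral.  The substitution
      L_i(v') removes x_i from the expanded function of (x_i, x_k, x_n), so that
      this function passes through the inner integral; S and then x_n := x_k
      turn it back into h(x_i).  The auxiliary variable x_n keeps the outer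
      occurrence of x_k apart from the inner one meanwhile.

    - [int_shear_int] is the exchange of integrals for S without coefficients.
      It is the case v' = () of the last axiom of a hierarchy, carried from the
      indices (0, 1) to (i, k) by transpositions and from w_k = 1 to any w_k by
      scaling x_i.

    - [int_triangular] says that the integral along x_k commutes with L_i(v') up
      to a constant of integration.  In [int_triangular_int] the contributions
      of this constant to the two terms of [int_shear_int] cancel, since it is
      free of x_k and therefore invariant under S. *)

(** * Products of matrices with sparse rows or columns *)

Section MatrixProducts.
Variable K : fieldType.
Implicit Types M N : imx K.

(** Finiteness of a matrix is a proposition, hence irrelevant. *)
Lemma imx_eq M N : (forall r c, M r c = N r c) -> M = N.
Proof.
case: M N => [f Hf] [g Hg] /= E.
have Efg : f = g by apply/funext => r; apply/funext => c.
by subst g; rewrite (Prop_irrelevance Hf Hg).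
Qed.

Lemma sum_bounded (f : nat -> K) m : (forall l, (m <= l)%N -> f l = 0) ->
  \sum_(l \in [set: nat]) f l = \sum_(l < m) f l.
Proof.
move=> f0; rewrite (fsbig_ord _ m f); apply/esym/fsbig_widen => //.
by move=> l [_ /= /negP]; rewrite -leqNgt => /f0.
Qed.

Lemma mul_bounded M N r c m :
  (forall l, (m <= l)%N -> M r l * N l c = 0) ->
  imx_mul M N r c = \sum_(l < m) M r l * N l c.
Proof. exact: sum_bounded. Qed.

(** The entries of a product are sums over all of nat; when row r of M is a
    finite combination of unit rows, row r of the product is the same
    combination of the rows of N. *)
Lemma mul_row M N r (s : seq (nat * K)) :
    (forall l, M r l = \sum_(x <- s) x.2 * delta K x.1 l) ->
  forall c, imx_mul M N r c = \sum_(x <- s) x.2 * N x.1 c.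
Proof.
move=> rowM c; pose m := \max_(x <- s) x.1.+1.
have lt_m x : x \in s -> (x.1 < m)%N.
  by move=> xs; apply: (@leq_bigmax_seq _ s predT (fun x : nat * K => x.1.+1)).

rewrite (@mul_bounded _ _ _ _ m) => [|l le_ml]; last first.
  rewrite rowM big1_seq ?mul0r // => x /andP[_ /lt_m lt_xm].
  by rewrite /delta ltn_eqF ?mulr0 // (leq_trans lt_xm).
under eq_bigr => l _ do rewrite rowM mulr_suml.
rewrite exchange_big /=; apply: eq_big_seq => x /lt_m lt_xm.
rewrite (bigD1 (Ordinal lt_xm)) //= /delta eqxx mulr1 big1 ?addr0 // => l.
by rewrite -val_eqE eq_sym => /= /negPf ->; rewrite mulr0 mul0r.
Qed.

Lemma mul_row1 M N r p : M r =1 delta K p ->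
  forall c, imx_mul M N r c = N p c.
Proof.
move=> E c; rewrite (@mul_row _ _ _ [:: (p, 1)]) ?big_seq1 ?mul1r // => l.
by rewrite big_seq1 mul1r E.
Qed.

Lemma mul_row2 M N r p q a b :
    (forall l, M r l = a * delta K p l + b * delta K q l) ->
  forall c, imx_mul M N r c = a * N p c + b * N q c.
Proof.
move=> E c; rewrite (@mul_row _ _ _ [:: (p, a); (q, b)]) => [|l].
  by rewrite !big_cons big_nil addr0.
by rewrite !big_cons big_nil addr0 E.
Qed.

Lemma mul_col M N c p a : (forall l, N l c = delta K l p * a) ->
  forall r, imx_mul M N r c = M r p * a.
Proof.
move=> E r; have f0 l : l != p -> M r l * N l c = 0.
  by move=> /negPf neq; rewrite E /delta neq mul0r mulr0.
rewrite (@mul_bounded _ _ _ _ p.+1) => [|l lt_pl].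
  2: by rewrite f0 // gtn_eqF.
rewrite (bigD1 ord_max) //= E /delta eqxx mul1r big1 ?addr0 // => l neq.
exact: f0.
Qed.

Lemma mul_col1 M N c p : (forall l, N l c = delta K l p) ->
  forall r, imx_mul M N r c = M r p.
Proof.
by move=> E r; rewrite (@mul_col _ _ _ p 1) ?mulr1 // => l; rewrite mulr1.
Qed.

Lemma imx1E r c : imx1 K r c = delta K r c.
Proof. by rewrite /imx1 /= /block_fun. Qed.

(** The substitution x_k := a x_k + b x_j.  With b = 0 it scales x_k, with
    a = b = 0 it sets x_k to 0, which is the evaluation E_k. *)
Definition imx_subst (k : nat) (a b : K) (j : nat) : imx K :=
  imx_block (maxn k j).+1
    (fun r c => if r == k then a * delta K k c + b * delta K j c
                else delta K r c).

Lemma substE k a b j r c : imx_subst k a b j r c =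
  if r == k then a * delta K k c + b * delta K j c else delta K r c.
Proof.
rewrite /= /block_fun; case: ifP => // /negbT.
rewrite negb_and -!leqNgt !gtn_max /delta.
by case: (eqVneq r k) => // ->; rewrite ltnn /= => /andP[ltk ltj];
  rewrite (ltn_eqF ltk) (ltn_eqF ltj) !mulr0 addr0.
Qed.

Definition swap (i j r : nat) : nat :=
  if r == i then j else if r == j then i else r.

Lemma swapK i j : involutive (swap i j).
Proof.
move=> r; rewrite /swap; case: (eqVneq r i) => [->|ri].
  by rewrite eqxx; case: eqVneq.
case: (eqVneq r j) => [->|rj]; first by rewrite eqxx.
by rewrite (negPf ri) (negPf rj).
Qed.

Lemma swap_inj i j : injective (swap i j).
Proof. exact: inv_inj (swapK i j). Qed.

(** Transpositions act transitively on ordered pairs of distinct indices, so a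
    swap-invariant law about two variables may be checked on x_0 and x_1. *)
Lemma pair_swap_ind (P : nat -> nat -> Prop) : P 0 1 ->
    (forall a b p q, P p q -> P (swap a b p) (swap a b q)) ->
  forall p q, p != q -> P p q.
Proof.
move=> P01 Pswap p q neq_pq.
have Pm m : m != 0%N -> P 0%N m.
  move/negPf=> m0; have := Pswap 1%N m _ _ P01.
  by rewrite /swap eqxx (eq_sym 0%N m) m0.
have s0 : swap 0 p 0 = p by [].
rewrite -{1}s0 -(swapK 0 p q); apply/Pswap/Pm.
by rewrite -[X in _ != X](swapK 0 p) (inj_eq (@swap_inj 0 p)) s0 eq_sym.
Qed.

Lemma delta_swap i j r c : delta K (swap i j r) c = delta K r (swap i j c).
Proof. by rewrite /delta -{2}(swapK i j r) (inj_eq (@swap_inj i j)). Qed.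

Lemma transpE i j r c : imx_transp K i j r c = delta K (swap i j r) c.
Proof.
rewrite /= /block_fun -/(swap i j r); case: ifP => // /negbT.
rewrite negb_and -!leqNgt !gtn_max => /orP[] /andP[lti ltj]; last first.
  by rewrite delta_swap /swap (gtn_eqF lti) (gtn_eqF ltj).
by rewrite /swap (gtn_eqF lti) (gtn_eqF ltj).
Qed.

Lemma of_size_block m (f : nat -> nat -> K) : of_size m (imx_block m f).
Proof.
by move=> r c H; rewrite /= /block_fun !ltnNge -negb_or H.
Qed.

Lemma of_size_le m n M : (m <= n)%N -> of_size m M -> of_size n M.
Proof.
by move=> le H r c /orP[le1|le1]; apply: H; rewrite (leq_trans le le1) ?orbT.
Qed.

Lemma entry_out i d (w : 'cV[K]_d) m :
  (m <= i)%N || (i + d < m)%N -> entry i w m = 0.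
Proof.
rewrite /entry; case: (ltnP i m) => //= lt_im le.
by case: insubP => //= p lt_p _; exfalso; lia.
Qed.

Lemma entry_in i d (w : 'cV[K]_d) (p : 'I_d) : entry i w (i.+1 + p) = w p ord0.
Proof.
rewrite /entry ltnS leq_addr addKn; case: insubP => [q _ /val_inj -> //|].
by rewrite ltn_ord.
Qed.

Lemma LE i d (w : 'cV[K]_d) r c :
  imx_L i w r c = delta K r c + entry i w r * delta K i c.
Proof.
rewrite /= /block_fun /delta (eq_sym i c); case: ifP => [_|/negbT].
  by case: (c == i); rewrite ?mulr1 ?mulr0.
rewrite negb_and -!leqNgt => /orP[le|le].
  by rewrite entry_out ?mul0r ?addr0 //; lia.
by rewrite (@gtn_eqF i c) ?mulr0 ?addr0 //; lia.
Qed.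

End MatrixProducts.

(** * Actions and integrals along arbitrary variables *)

Section Hierarchy.
Variables (K : fieldType) (F : rbHierarchy K).
Implicit Types (M N : imx K) (f g u : F).

Local Notation act := (hact F).
Local Notation int := (hint F).
Local Notation E k := (imx_subst k 0 0 k).

Let rbF : is_rb_hierarchy (hcomp F) act int := rbhP F.
Let hierF : is_hierarchy (hcomp F) act := rbh_hier rbF.

Lemma in_union f : (\bigcup_n hcomp F n) f.
Proof. by rewrite rbh_union. Qed.
Local Hint Resolve in_union : core.

Lemma act_is_linear M : linear (act M).
Proof. by move=> a f g; apply: (hier_act_linear hierF). Qed.
HB.instance Definition _ M :=
  GRing.isLinear.Build K F F *:%R (act M) (act_is_linear M).

Lemma int_is_linear n : linear (int n).
Proof. by move=> a f g; apply: (rbh_linear rbF). Qed.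
HB.instance Definition _ n :=
  GRing.isLinear.Build K F F *:%R (int n) (int_is_linear n).

Lemma actZ M (a : K) f : act M (a *: f) = a *: act M f.
Proof. exact: linearZ. Qed.

Lemma act_sum M r (f : 'I_r -> F) :
  act M (\sum_(mu < r) f mu) = \sum_(mu < r) act M (f mu).
Proof. exact: linear_sum. Qed.

Lemma int_sum n r (f : 'I_r -> F) :
  int n (\sum_(mu < r) f mu) = \sum_(mu < r) int n (f mu).
Proof. exact: linear_sum. Qed.

Lemma actM M f g : act M (f * g) = act M f * act M g.
Proof. exact: (hier_act_mul hierF). Qed.

Lemma act_comp M N f : act N (act M f) = act (imx_mul M N) f.
Proof. by rewrite (hier_actM hierF). Qed.

Lemma act_eq M N f : (forall r c, M r c = N r c) -> act M f = act N f.
Proof. by move/imx_eq ->. Qed.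

Lemma act_id M f : (forall r c, M r c = delta K r c) -> act M f = f.
Proof.
move=> M1; rewrite -[RHS](hier_act1 hierF) //; apply: act_eq => r c.
by rewrite imx1E.
Qed.

Lemma act_rows n M N f : hcomp F n f ->
  (forall r c, (r < n)%N -> M r c = N r c) -> act M f = act N f.
Proof.
move=> Fnf MN; rewrite (hier_straight hierF M Fnf).
rewrite [RHS](hier_straight hierF N Fnf).
by apply: act_eq => r c; rewrite /= /cut_fun; case: ifP => // /MN ->.
Qed.

Lemma act_fix n M f : hcomp F n f ->
  (forall r c, (r < n)%N -> M r c = delta K r c) -> act M f = f.
Proof.
move=> Fnf M1; rewrite -[RHS](hier_act1 hierF) //; apply: (act_rows Fnf) => r c.
by rewrite imx1E; apply: M1.
Qed.

Lemma comp_le m n f : (m <= n)%N -> hcomp F m f -> hcomp F n f.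
Proof.
move=> /subnK <-; elim: (n - m)%N => // d IHd Ff.
exact/(hier_ascending hierF)/IHd.
Qed.

Lemma comp_act n M f : of_size n M -> hcomp F n f -> hcomp F n (act M f).
Proof. exact: (hier_act_comp hierF). Qed.

Lemma comp_int n m f : (n < m)%N -> hcomp F m f -> hcomp F m (int n f).
Proof. exact: (rbh_comp rbF). Qed.

Lemma comp_mul n f g : hcomp F n f -> hcomp F n g -> hcomp F n (f * g).
Proof.
move=> Ff Fg; have [_ _ closed] := hier_subalg hierF n.
exact/set_mem/(closed f g (mem_set Ff) (mem_set Fg)).
Qed.

Lemma exists_comp n f : exists2 m, (n <= m)%N & hcomp F m f.
Proof.
have [m _ Fmf] := in_union f; exists (maxn m n); first exact: leq_maxr.
exact: comp_le (leq_maxl _ _) Fmf.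
Qed.

Lemma act_transpK i j f : act (imx_transp K i j) (act (imx_transp K i j) f) = f.
Proof.
rewrite act_comp; apply: act_id => r c.
rewrite (@mul_row1 _ _ _ _ (swap i j r)) => [|l]; last by rewrite transpE.
by rewrite transpE swapK.
Qed.

Lemma transp_subst a b k x y j f :
  act (imx_transp K a b) (act (imx_subst k x y j) f) =
  act (imx_subst (swap a b k) x y (swap a b j)) (act (imx_transp K a b) f).
Proof.
rewrite !act_comp; apply: act_eq => r c.
rewrite [RHS](@mul_row1 _ _ _ _ (swap a b r)) => [|l]; last by rewrite transpE.
rewrite substE (inj_eq (@swap_inj a b)).
case: (eqVneq r k) => [->|neq].
  rewrite (@mul_row2 _ _ _ _ k j x y) ?transpE // => l.
  by rewrite substE eqxx.
by rewrite (@mul_row1 _ _ _ _ r) ?transpE // => l; rewrite substE (negPf neq).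
Qed.

Lemma int_transp i j f :
  int j (act (imx_transp K i j) f) = act (imx_transp K i j) (int i f).
Proof. by rewrite (rbh_transp rbF). Qed.

(** A matrix with trivial row and column 0 has the form diag(1, M'). *)
Lemma int0_act M f : (forall c, M 0%N c = delta K 0 c) ->
  (forall r, M r 0%N = delta K r 0) -> int 0%N (act M f) = act M (int 0%N f).
Proof.
move=> row0 col0; have fin : exists m, of_size m (fun r c => M r.+1 c.+1).
  have [m Mm] := imx_fin M; exists m => r c le.
  rewrite Mm; last by case/orP: le => /leqW ->; rewrite ?orbT.
  by rewrite /delta eqSS.
have ME r c : M r c = imx_shift 1 (Imx fin) r c.
  rewrite /= /shift_fun; case: r c => [|r] [|c] //=; first by rewrite !subn1.
by rewrite !(act_eq _ ME) (rbh_shift rbF).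
Qed.

(** The axioms state this for l below the support of M only; the transposition
    (0 l) brings any l to that position. *)
Lemma int_act l M f : (forall c, M l c = delta K l c) ->
  (forall r, M r l = delta K r l) -> int l (act M f) = act M (int l f).
Proof.
move=> rowl coll; set t := imx_transp K 0 l.
pose N := imx_mul (imx_mul t M) t.
have actN u : act N u = act t (act M (act t u)) by rewrite -!act_comp.
have tM r c : imx_mul t M r c = M (swap 0 l r) c.
  by apply: mul_row1 => s; rewrite transpE.
have Mt r c : N r c = M (swap 0 l r) (swap 0 l c).
  rewrite (@mul_col1 _ _ _ _ (swap 0 l c)) ?tM // => s.
  by rewrite transpE delta_swap.
(* N is M conjugated by (0 l), hence trivial in row and column 0. *)
have commN u : int 0%N (act N u) = act N (int 0%N u).
  have s0 : swap 0 l 0 = l by [].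
  have sl : swap 0 l l = 0%N by rewrite -{2}s0 swapK.
  apply: int0_act => [c|r]; rewrite Mt s0; first by rewrite rowl -delta_swap sl.
  by rewrite coll delta_swap sl.
rewrite -[f in LHS](act_transpK 0 l) -/t -[act M _](act_transpK 0 l) -/t -actN.
rewrite int_transp commN actN act_transpK -int_transp.
by rewrite act_transpK.
Qed.

Lemma int_swap a b l f :
  int (swap a b l) (act (imx_transp K a b) f) =
  act (imx_transp K a b) (int l f).
Proof.
case: (eqVneq l a) => [->|la]; first by rewrite /swap eqxx int_transp.
case: (eqVneq l b) => [->|lb].
  have tC : imx_transp K a b = imx_transp K b a.
    apply: imx_eq => r c; rewrite !transpE /swap.
    by case: (eqVneq r a) => [->|]; case: eqVneq => // <-.
  have -> : swap a b b = a by rewrite /swap eqxx; case: eqVneq.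
  by rewrite tC int_transp.
have sl : swap a b l = l by rewrite /swap (negPf la) (negPf lb).
by rewrite sl int_act // => r; rewrite transpE ?sl // delta_swap sl.
Qed.

Lemma int_subst l k x y j f : l != k -> l != j ->
  int l (act (imx_subst k x y j) f) = act (imx_subst k x y j) (int l f).
Proof.
move=> /negPf lk /negPf lj; apply: int_act => r; rewrite substE ?lk //.
by case: eqP => // ->; rewrite /delta !(eq_sym _ l) lk lj !mulr0 addr0.
Qed.

Lemma subst_E k : imx_E K k = E k.
Proof.
apply: imx_eq => r c; rewrite substE /= /block_fun !ltnS.
case: (eqVneq r k) => [->|rk] /=; last by rewrite subr0; case: ifP.
rewrite leqnn !mul0r addr0 /= /delta (eq_sym c k); case: ifP => [_|].
  exact: subrr.
by case: (eqVneq k c) => // <-; rewrite leqnn.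
Qed.

(** The axiom about the evaluation E_m speaks of the integral along the last
    variable of F_{m+1}; swapping x_k with an x_m beyond all variables of f
    makes it the last one. *)
Lemma E_int k f : act (E k) (int k f) = 0.
Proof.
have [m le_km Fmf] := exists_comp k f.
apply: (can_inj (act_transpK k m)).
rewrite transp_subst -int_swap {1 2 3}/swap eqxx -subst_E linear0.
have F1 : hcomp F m.+1 (act (imx_transp K k m) f).
  apply: comp_act (comp_le (leqnSn _) Fmf).
  by apply: of_size_le (of_size_block _); rewrite ltnS geq_max le_km /=.
have F0 : hcomp F m 0.
  apply: (comp_le (leq0n m)); rewrite (hier_base hierF).
  by exists 0 => //; rewrite scale0r.
by have := orb_ev (rbh_ordinary rbF m) F0 F1; rewrite add0r.
Qed.

(** A coefficient free of x_l is a constant for the integral along x_l.  After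
    swapping x_l with a variable x_m beyond all others it lies in F_m, over
    which that integral is linear. *)
Lemma int_mul_const l (c : F) f :
  act (E l) c = c -> int l (c * f) = c * int l f.
Proof.
move=> Ec; have [m1 le1 Fc] := exists_comp l c.
have [m le2 Ff] := exists_comp m1 f.
have le_lm := leq_trans le1 le2.
have sz : of_size m.+1 (imx_transp K l m).
  by apply: of_size_le (of_size_block _); rewrite ltnS geq_max le_lm /=.
apply: (can_inj (act_transpK l m)).
rewrite -int_swap actM [RHS]actM -int_swap.
have -> : swap l m l = m by rewrite /swap eqxx.
apply: (orb_scale (rbh_ordinary rbF m)); last first.
  by apply: comp_act sz (comp_le (leqnSn _) Ff).
rewrite -Ec transp_subst.
have -> : swap l m l = m by rewrite /swap eqxx.
rewrite -subst_E; apply: (hier_act_E hierF); apply: comp_act sz _.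
exact: comp_le (leqW le2) Fc.
Qed.

(** * Integrals and shears *)

Lemma int_scal k a f : a != 0 ->
  int k (act (imx_subst k a 0 k) f) = a^-1 *: act (imx_subst k a 0 k) (int k f).
Proof.
move=> a0; apply: (can_inj (act_transpK k 0)).
have s0 : swap k 0 k = 0%N by rewrite /swap eqxx.
rewrite linearZ /= transp_subst -!int_swap transp_subst s0.
have -> : imx_subst 0 a 0 0 = imx_scal a.
  apply: imx_eq => r c; rewrite substE /= /block_fun /delta.
  by case: r c => [|r] [|c] //=; rewrite ?mulr0 ?mulr1 ?mul0r ?addr0.
by rewrite (rbh_scal rbF).
Qed.

(** Scaling x_j reduces a shear by a to the unit shear. *)
Lemma shear_scal k j (a : K) f : k != j -> a != 0 ->
  act (imx_subst k 1 a j) f =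
  act (imx_subst j a 0 j)
    (act (imx_subst k 1 1 j) (act (imx_subst j a^-1 0 j) f)).
Proof.
move=> kj a0; rewrite [act (imx_subst k _ _ _) (act _ _)]act_comp act_comp.
apply: act_eq => r c.
have rowM r' : imx_mul (imx_subst j a^-1 0 j) (imx_subst k 1 1 j) r' =1
    fun c => if r' == k then delta K k c + delta K j c
             else (if r' == j then a^-1 else 1) * delta K r' c.
  move=> c'; case: (eqVneq r' j) => [->|rj].
    rewrite (@mul_row2 _ _ _ _ j j a^-1 0) => [|l]; last by rewrite substE eqxx.
    by rewrite substE eq_sym (negPf kj) mul0r addr0.
  rewrite (@mul_row1 _ _ _ _ r') => [|l]; last by rewrite substE (negPf rj).
  by rewrite substE; case: eqP; rewrite !mul1r.
rewrite substE; case: (eqVneq r k) => [->|rk].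
  rewrite (@mul_row2 _ _ _ _ k j 1 1) => [|l]; last by rewrite rowM eqxx !mul1r.
  by rewrite !substE eqxx (negPf kj) !mul1r mul0r addr0.
case: (eqVneq r j) => [->|rj]; last first.
  rewrite (@mul_row1 _ _ _ _ r) => [|l].
  2: by rewrite rowM (negPf rk) (negPf rj) mul1r.
  by rewrite substE (negPf rj).
rewrite (@mul_row2 _ _ _ _ j j a^-1 0) => [|l].
  by rewrite substE eqxx !mul0r !addr0 mulrA mulVf ?mul1r.
by rewrite rowM eq_sym (negPf kj) eqxx mul0r addr0.
Qed.

Lemma int_unit_shear k j f : k != j ->
  let S := imx_subst k 1 1 j in
  int k (act S f) = act S (int k f) - act (E k) (act S (int k f)).
Proof.
move=> kj; move: k j kj f; apply: pair_swap_ind => [f S|a b k j IH f S].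
  rewrite -subst_E; have -> : S = imx_T1 K.
    apply: imx_eq => r c; rewrite substE /= /block_fun /delta.
    by case: r c => [|[|r]] [|[|c]] //=; rewrite ?mul1r ?addr0 ?add0r.
  by rewrite (rbh_T1 rbF).
rewrite -[f](act_transpK a b); move: (act _ f) => {}f.
by rewrite -transp_subst !int_swap IH linearB /= !transp_subst.
Qed.


Lemma substC k x j y f : k != j ->
  act (imx_subst k x 0 k) (act (imx_subst j y 0 j) f) =
  act (imx_subst j y 0 j) (act (imx_subst k x 0 k) f).
Proof.
move=> kj; rewrite !act_comp; apply: act_eq => r c.
have prod p a q b r' : p != q ->
    imx_mul (imx_subst p a 0 p) (imx_subst q b 0 q) r' c =
    (if r' == p then a else if r' == q then b else 1) * delta K r' c.
  move=> /negPf pq; case: (eqVneq r' p) => [->|rp].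
    rewrite (@mul_row2 _ _ _ _ p p a 0) => [|l]; last by rewrite substE eqxx.
    by rewrite !substE pq mul0r addr0.
  rewrite (@mul_row1 _ _ _ _ r') => [|l]; last by rewrite substE (negPf rp).
  by rewrite substE; case: eqP => [->|]; rewrite ?mul0r ?addr0 ?mul1r.
rewrite !prod // 1?eq_sym //; congr (_ * _).
by case: (eqVneq r j) => [->|//]; rewrite eq_sym (negPf kj).
Qed.

(** Substitution rule for x_k := x_k + a x_j.  The integral starting at x_k = 0
    becomes one starting at a x_j; the subtracted term accounts for this. *)
Lemma int_shear k j (a : K) f : k != j ->
  let S := imx_subst k 1 a j in
  int k (act S f) = act S (int k f) - act (E k) (act S (int k f)).
Proof.
move=> kj S; case: (eqVneq a 0) => [a0|a0].
  have S1 u : act S u = u.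
    apply: act_id => r c; rewrite substE a0 mul1r mul0r addr0.
    by case: eqP => [->|].
  by rewrite !S1 E_int subr0.
by rewrite /S !(shear_scal _ kj a0) !(int_subst _ _ _ kj kj) int_unit_shear //
  int_subst // linearB substC.
Qed.

Lemma int_unit_shear_int i k f : i != k ->
  let S := imx_subst k 1 1 i in
  int i (act S (int i f)) = act S (int i (int k f)) - int i (act S (int k f)).
Proof.
move=> ki; move: i k ki f; apply: pair_swap_ind => [f S|a b i k IH f S].
  (* The axiom with an empty column: there are no variables beyond x_1, and
     its factors L_1 are the identity. *)
  have := rbh_L1 rbF (0 : 'cV[K]_0) (in_union f) => /=.
  have L1 (w : 'cV[K]_0) u : act (imx_L 1 w) u = u.
    by apply: act_id => r c; rewrite LE entry_out ?mul0r ?addr0 //; lia.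
  have entry1 (w : 'cV[K]_(1 + 0)) : entry 0 w 1 = w ord0 ord0.
    exact: (entry_in 0 w ord0).
  have -> : imx_L 0 (delta_mx ord0 ord0 : 'cV[K]_(1 + 0)) = S.
    apply: imx_eq => r c; rewrite LE substE.
    case: r => [|[|r]]; try by rewrite entry_out ?mul0r ?addr0.
    by rewrite entry1 mxE mul1r.
  have -> : imx_L 0 ((delta_mx ord0 ord0 : 'cV[K]_(1 + 0))
                     + col_mx 0 (0 : 'cV[K]_0)) = S.
    apply: imx_eq => r c; rewrite LE substE.
    case: r => [|[|r]]; try by rewrite entry_out ?mul0r ?addr0.
    rewrite entry1 !mxE.
    by case: splitP => [j _|[]//]; rewrite mxE addr0 !mul1r.
  by rewrite !L1.
rewrite -[f](act_transpK a b); move: (act _ f) => {}f.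
by rewrite !(int_swap, =^~ transp_subst) IH linearB.
Qed.

(** Exchange of the order of integration over a triangle.  The scaling of x_i
    contributes the factor 1 / a twice on the left and is undone once on the
    right, which leaves one factor 1 / a. *)
Lemma int_shear_int i k (a : K) f : i != k -> a != 0 ->
  let S := imx_subst k 1 a i in
  int i (act S (int i f)) =
  a^-1 *: (act S (int i (int k f)) - int i (act S (int k f))).
Proof.
move=> ik a0 S; have ki : k != i by rewrite eq_sym.
have Va0 : a^-1 != 0 by rewrite invr_eq0.
pose D := imx_subst i a 0 i; pose D' := imx_subst i a^-1 0 i.
have intD u : act D (int i u) = a *: int i (act D u).
  by rewrite int_scal // scalerA divff // scale1r.
have intD' u : act D' (int i u) = a^-1 *: int i (act D' u).
  by rewrite int_scal // invrK scalerA mulVf // scale1r.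
have SE u : act S u = act D (act (imx_subst k 1 1 i) (act D' u)).
  exact: shear_scal.
have -> : act S (int i f) =
    a^-1 *: act D (act (imx_subst k 1 1 i) (int i (act D' f))).
  by rewrite SE intD' !linearZ.
rewrite linearZ /= int_scal // int_unit_shear_int // [int k _]int_subst //.
rewrite -/D -/D'.
move: (int k f) => z.
have e1 : act D (act (imx_subst k 1 1 i) (int i (act D' z))) =
    a *: act S (int i z).
  by rewrite SE intD' !linearZ /= scalerA mulVf // scale1r.
have e2 : act D (int i (act (imx_subst k 1 1 i) (act D' z))) =
    a *: int i (act S z).
  by rewrite SE intD.
by rewrite linearB /= e1 e2 -scalerBr !scalerA -mulrA mulVf // mulr1.
Qed.

(** M is the product of the shear x_k := x_k + a x_j and a matrix N with trivial
    row and column k, which commutes with the integral along x_k. *)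
Lemma int_triangular k j (a : K) M f : k != j ->
    (forall c, M k c = delta K k c + a * delta K j c) ->
    (forall c, M j c = delta K j c) -> (forall r, M r k = delta K r k) ->
  int k (act M f) = act M (int k f) - act (E k) (act M (int k f)).
Proof.
move=> kj rowk rowj colk.
pose N := imx_mul (imx_subst k 1 (- a) j) M.
have rowN r c : N r c = if r == k then delta K k c else M r c.
  case: eqP => [->|/eqP/negPf rk].
    rewrite (@mul_row2 _ _ _ _ k j 1 (- a)) => [|l].
    2: by rewrite substE eqxx.
    by rewrite rowk rowj; ring.
  by rewrite (@mul_row1 _ _ _ _ r) => [//|l]; rewrite substE rk.
have intN u : int k (act N u) = act N (int k u).
  apply: int_act => r; rewrite rowN ?eqxx //; case: eqP => // ->.
  by rewrite /delta.
have colN r : N r k = delta K r k by rewrite rowN; case: eqP => [->|].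
have EN u : act (E k) (act N u) = act N (act (E k) u).
  rewrite !act_comp; apply: act_eq => r c.
  case: (eqVneq r k) => [->|rk].
    rewrite [RHS](@mul_row2 _ _ _ _ k k 0 0) => [|l].
    2: by rewrite substE eqxx.
    rewrite (@mul_row1 _ _ _ _ k) => [|l]; last by rewrite rowN eqxx.
    by rewrite substE eqxx !mul0r.
  rewrite [RHS](@mul_row1 _ _ _ _ r) => [|l]; last by rewrite substE (negPf rk).
  case: (eqVneq c k) => [->|ck].
    rewrite colN (@mul_col _ _ _ _ k 0) => [|l].
      by rewrite mulr0 /delta (negPf rk).
    rewrite substE !mul0r addr0 mulr0.
    by case: eqP => [_ //|/eqP/negPf lk]; rewrite /delta lk.
  rewrite (@mul_col1 _ _ _ _ c) // => l; rewrite substE.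
  by case: eqP => // ->; rewrite !mul0r addr0 /delta (eq_sym k) (negPf ck).
have ME u : act M u = act N (act (imx_subst k 1 a j) u).
  rewrite act_comp; apply: act_eq => r c.
  case: (eqVneq r k) => [->|rk].
    rewrite (@mul_row2 _ _ _ _ k j 1 a) => [|l]; last by rewrite substE eqxx.
    by rewrite !rowN eqxx rowk (eq_sym j) (negPf kj) rowj mul1r.
  rewrite (@mul_row1 _ _ _ _ r) => [|l]; last by rewrite substE (negPf rk).
  by rewrite rowN (negPf rk).
by rewrite !ME intN int_shear // linearB /= EN.
Qed.

(** With p = g M^* y, the inner integral along x_k is p - E_k^* p.  The part
    E_k^* p is free of x_k, so S fixes it and its two contributions cancel. *)
Lemma int_triangular_int i k (a b : K) M f g : i != k -> a != 0 ->
    (forall c, M k c = delta K k c + b * delta K i c) ->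
    (forall c, M i c = delta K i c) -> (forall r, M r k = delta K r k) ->
    act (E k) g = g ->
  let S := imx_subst k 1 a i in let y := int k f in
  int i (act S (int i (g * act M f))) =
  a^-1 *: (act S (int i (g * act M y)) - int i (act S (g * act M y))).
Proof.
move=> ik a0 rowk rowi colk Eg S y; have ki : k != i by rewrite eq_sym.
rewrite int_shear_int //; congr (_ *: _); rewrite -/S.
rewrite int_mul_const // (int_triangular _ ki rowk) // -/y mulrBr.
set p := g * act M y.
have -> : g * act (E k) (act M y) = act (E k) p by rewrite actM Eg.
(* S changes x_k only, which E_k removes. *)
have SE u : act S (act (E k) u) = act (E k) u.
  rewrite act_comp; apply: act_eq => r c; rewrite substE.
  case: (eqVneq r k) => [->|rk].
    rewrite (@mul_row2 _ _ _ _ k k 0 0) => [|l]; last by rewrite substE eqxx.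
    by rewrite !mul0r.
  rewrite (@mul_row1 _ _ _ _ r) => [|l]; last by rewrite substE (negPf rk).
  by rewrite substE (negPf rk).
rewrite !linearB /= SE int_subst // SE.
by rewrite opprK addrACA addNr addr0.
Qed.

(** * Coefficients *)

Variable G : coefDomain F.
Implicit Types x : G.

Lemma comp_embed x : hcomp F 1 (embed x).
Proof. by case: (cd_sub G) => + _; apply; exists (tpure [ffun=> x]). Qed.

(** A function of x_0 sees the row 0 of a substitution only; this turns all
    identities between transforms of one coefficient into identities of rows. *)
Lemma act_embed M N x : (forall c, M 0%N c = N 0%N c) ->
  act M (embed x) = act N (embed x).
Proof. by move=> MN; apply: (act_rows (comp_embed x)) => -[]. Qed.

Lemma at_varE x j M : (forall c, M 0%N c = delta K j c) ->
  at_var x j = act M (embed x).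
Proof. by move=> Mj; apply: act_embed => c; rewrite Mj transpE. Qed.

Lemma act_at_var M j p x : (forall c, M j c = delta K p c) ->
  act M (at_var x j) = at_var x p.
Proof.
move=> Mj; rewrite /at_var act_comp; apply/esym/at_varE => c.
by rewrite (@mul_row1 _ _ _ _ j) // => l; rewrite transpE.
Qed.

Lemma comp_at_var x j n : (j < n)%N -> hcomp F n (at_var x j).
Proof.
move=> lt_jn; apply: (comp_le lt_jn); apply: comp_act.
  by apply: of_size_le (of_size_block _); rewrite max0n.
exact: comp_le (comp_embed x).
Qed.

Lemma at_var1 j : at_var (1 : G) j = 1.
Proof.
rewrite /at_var /embed.
have -> : tpure [ffun=> (1 : G)] = tone G 1 by [].
by rewrite (ind_unit (cd_induced G)) (hier_act_unit hierF).
Qed.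

(** Apply the formula for the action on tensors to the identity matrix: its
    factors are the row actions that also define [at_var]. *)
Lemma emb_tpure n (u : {ffun 'I_n -> G}) :
  @cd_emb K F G n (tpure u) = \prod_(r < n) at_var (u r) r.
Proof.
have indG := cd_induced G.
rewrite -[LHS](hier_act1 hierF) // (ind_act indG _ (leqnn n)); last first.
  by move=> r c _; rewrite imx1E.
apply: eq_bigr => r _; rewrite /at_var /embed (ind_act indG (N := n)).
- rewrite big_ord1 ffunE; congr (cd_emb (row_act _ _ _ _ _ _)).
  by apply/funext => c; rewrite transpE imx1E.
- exact: leq_ltn_trans (ltn_ord r).
- by apply: of_size_le (of_size_block _); rewrite max0n.
Qed.

Lemma expansion_component (I : eqType) (b : I -> G) i k n y
    (e : expansion b n.+1 [:: i; k; n] y) : (i < k < n)%N ->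
  y = \sum_(mu < ex_size e)
        component (e := e) i mu * component (e := e) k mu *
        component (e := e) n mu.
Proof.
case/andP=> lt_ik lt_kn; rewrite {1}(ex_eq e).
pose emb := cd_emb (c := G) (n := n.+1).
have embZ : linear emb := @ind_linear _ _ _ _ _ _ (cd_induced G) n.+1.
pose embL := GRing.isLinear.Build K (tpow G n.+1) F *:%R emb embZ.
pose emb' : {linear tpow G n.+1 -> F} := HB.pack emb embL.
rewrite -/emb -[emb]/(emb' : _ -> _) linear_sum /=; apply: eq_bigr => mu _.
rewrite /emb emb_tpure.
have lt_in := ltn_trans lt_ik lt_kn.
rewrite (bigD1 (Ordinal (leqW lt_in : i < n.+1)%N)) //=.
rewrite (bigD1 (Ordinal (leqW lt_kn : k < n.+1)%N)) /=; last first.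
  by rewrite -val_eqE /= gtn_eqF.
rewrite (bigD1 (Ordinal (ltnSn n))) /=; last first.
  by rewrite -!val_eqE /= !gtn_eqF.
rewrite big1 => [|r]; last first.
  rewrite -!val_eqE /= ffunE => /andP[/andP[ri rk] rn].
  by rewrite /ex_factor !inE (negPf ri) (negPf rk) (negPf rn) at_var1.
by rewrite !ffunE /= mulr1 !mulrA.
Qed.

(** The hypothesis on R says that R^* h = h((x_k - x_n - t x_i) / a), and M is
    the substitution x_k := x_k + t x_i, up to variables other than x_i, x_k. *)
Lemma pull_coefficient (I : eqType) (b : I -> G) i k n (a t : K) M R (g h : G) f
    (e : expansion b n.+1 [:: i; k; n] (act R (embed h))) :
    (i < k < n)%N -> a != 0 ->
    (forall c, R 0%N c =
       - (t / a) * delta K i c + a^-1 * delta K k c - a^-1 * delta K n c) ->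
    of_size n M -> (forall c, M k c = delta K k c + t * delta K i c) ->
    (forall c, M i c = delta K i c) ->
    hcomp F n f ->
  let S := imx_subst k 1 a i in
  int i (at_var h i * act S (int i (at_var g i * act M f))) =
  \sum_(mu < ex_size e) act (imx_transp K k n) (component (e := e) n mu) *
     int i (act S (int i (at_var g i * component (e := e) i mu *
                          act M (component (e := e) k mu * f)))).
Proof.
move=> /andP[lt_ik lt_kn] a0 row0 szM rowk rowi Ff S.
have lt_in := ltn_trans lt_ik lt_kn.
have rown c : M n c = delta K n c by rewrite szM // leqnn.
set C := act M (act R (embed h)).
have CE : C = \sum_(mu < ex_size e)
    component (e := e) i mu * act M (component (e := e) k mu) *
    component (e := e) n mu.
  rewrite /C {1}(expansion_component e) ?lt_ik // act_sum.
  apply: eq_bigr => mu _.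
  by rewrite !actM /component (act_at_var _ rowi) (act_at_var _ rown).
pose P := imx_mul R M.
have rowP c : P 0%N c = a^-1 * delta K k c - a^-1 * delta K n c.
  rewrite (@mul_row _ _ _ _ [:: (i, - (t / a)); (k, a^-1); (n, - a^-1)]).
    by rewrite !big_cons big_nil /= rowi rowk rown; field.
  by move=> l; rewrite row0 !big_cons big_nil /=; ring.
have rowPN N : forall c, imx_mul P N 0%N c = a^-1 * N k c - a^-1 * N n c.
  move=> c; rewrite (@mul_row2 _ _ _ _ k n a^-1 (- a^-1)) ?mulNr // => l.
  by rewrite rowP mulNr.
have CP : C = act P (embed h) by rewrite /C act_comp.
(* C = h((x_k - x_n) / a) is free of x_i. *)
have EC : act (E i) C = C.
  rewrite CP act_comp; apply: act_embed => c; rewrite rowPN rowP !substE.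
  by rewrite !gtn_eqF.
have Ei j x : i != j -> act (E i) (at_var x j) = at_var x j.
  by move=> ij; apply: act_at_var => c; rewrite substE eq_sym (negPf ij).
have ni : i != n by rewrite ltn_eqF.
have ki : i != k by rewrite ltn_eqF.
have szS : of_size n S.
  by apply: of_size_le (of_size_block _); rewrite gtn_max lt_kn.
set X := int i (at_var g i * act M f).
pose A mu := act S (int i (at_var g i * component (e := e) i mu *
                          act M (component (e := e) k mu * f))).
have FX : hcomp F n (act S X).
  apply/comp_act/comp_int => //; apply/comp_mul; first exact: comp_at_var.
  exact: comp_act.
have FA mu : hcomp F n (A mu).
  apply/comp_act/comp_int => //; apply/comp_mul.
    by apply: comp_mul; apply: comp_at_var.
  by apply: comp_act => //; apply: comp_mul => //; apply: comp_at_var.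
(* Both sides are S^* applied to the integral of C g M^* f. *)
have key : act S C * act S X =
    \sum_(mu < ex_size e) component (e := e) n mu * A mu.
  rewrite -actM /X -int_mul_const // CE mulr_suml int_sum act_sum.
  apply: eq_bigr => mu _.
  have Sn : act S (component (e := e) n mu) = component (e := e) n mu.
    by apply: act_at_var => c; rewrite substE gtn_eqF.
  rewrite -[in RHS]Sn /A -actM -int_mul_const ?Ei // !actM.
  congr (act S (int i _)).
  by rewrite /component; ring.
(* Elements of F_n do not involve x_n, so x_n := x_k fixes the A mu. *)
pose Z : imx K := imx_subst n 0 1 k.
have ZF u : hcomp F n u -> act Z u = u.
  by move=> Fu; apply: (act_fix Fu) => r c lt_rn; rewrite substE ltn_eqF.
have Zn x : act Z (at_var x n) = at_var x k.
  by apply: act_at_var => c; rewrite substE eqxx mul0r add0r mul1r.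
(* (x_k + a x_i - x_n) / a becomes x_i. *)
have hE : act Z (act S C) = at_var h i.
  rewrite CP [act S _]act_comp act_comp; apply/esym/at_varE => c.
  pose Q := imx_mul P S.
  have rowQ l : Q 0%N l = a^-1 * delta K k l - a^-1 * delta K n l + delta K i l.
    rewrite rowPN !substE eqxx gtn_eqF //; field; exact: a0.
  rewrite (@mul_row _ _ _ _ [:: (k, a^-1); (n, - a^-1); (i, 1)]).
    rewrite !big_cons big_nil /Z !substE eqxx !ltn_eqF //=; ring.
  by move=> l; rewrite rowQ !big_cons big_nil /=; ring.
rewrite -hE -(ZF _ FX) -actM key act_sum int_sum; apply: eq_bigr => mu _.
rewrite actM Zn ZF // (@act_at_var _ n k) => [|c]; last first.
  by rewrite transpE /swap gtn_eqF // eqxx.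
by rewrite int_mul_const ?Ei.
Qed.

End Hierarchy.
(** * The double integral *)

Theorem proposition4p7 (K : fieldType) (charK0 : [pchar K] =i pred0)
    (F : rbHierarchy K) (G : coefDomain F)
    (I : eqType) (b : I -> G) (basis_b : is_basis b)
    (i n : nat) (lt_in : (i.+1 < n)%N)
    (v w : 'cV[K]_(n - i.+1)) (w_neq0 : w != 0) (g h : G)
    (k : nat) (pivot_k : is_pivot i w k) :
  let wk := entry i w k in
  let wbar : 'cV[K]_(n - i.+1) :=
    \col_p (if p == (k - i.+1)%N :> nat then wk else 0) in
  let w' : 'cV[K]_(n - k.+1) := \col_p (entry i w (k.+1 + p) / wk) in
  let v' : 'cV[K]_(n - i.+1) :=
    trunc_mx (n - i.+1) (imx_L (k - i.+1) (- w')) *m v in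
  let a : 'rV[K]_n.+1 := \row_(j < n.+1)
    (- (entry i v' k / wk) * (j == i :> nat)%:R
       + wk^-1 * (j == k :> nat)%:R - wk^-1 * (j == n :> nat)%:R) in
  let htilde : F := hact F (imx_row a) (embed h) in
  forall e : expansion b n.+1 [:: i; k; n] htilde,
  let chi'' mu := component (e := e) n mu in
  let chi' mu := component (e := e) i mu in
  let chi mu := component (e := e) k mu in
  (* wk^-1 is the Jacobian of the substitution of x_k for x_i; it is 1 for
     wk = 1. *)
  forall f : F, hcomp F n f ->
    hint F i (at_var h i * hact F (imx_L i w)
      (hint F i (at_var g i * hact F (imx_L i v) f)))
    = wk^-1 *: \sum_(mu < ex_size e)
        hact F (imx_L k (- w'))
          (hact F (imx_transp K k n) (chi'' mu) *
             (let y := hint F k (chi mu * hact F (imx_L k w') f) in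
              hact F (imx_L i wbar)
                (hint F i (at_var g i * chi' mu * hact F (imx_L i v') y))
              - hint F i (at_var g i * chi' mu *
                           hact F (imx_L i (v' + wbar)) y))).
Proof.
move=> wk wbar w' v' a htilde e chi'' chi' chi f Ff.
have [lt_ik wk0 wlt] := pivot_k.
have lt_kn : (k < n)%N.
  rewrite ltnNge; apply: contra wk0 => le_nk.
  by rewrite entry_out ?eqxx //; lia.
have ik : i != k by rewrite ltn_eqF.
have entry_w' m : (k < m)%N -> entry k w' m = entry i w m / wk.
  move=> lt_km; case: (ltnP m n) => [lt_mn|le_nm]; last first.
    have -> : entry i w m = 0 by apply: entry_out; lia.
    by rewrite mul0r; apply: entry_out; lia.
  have lt_p : (m - k.+1 < n - k.+1)%N by lia.
  by have := entry_in k w' (Ordinal lt_p); rewrite /= subnKC // mxE /= subnKC.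
(* w = w_k (e_k + w'), the reason for L_i(w) L_k(w') = L_k(w') S. *)
have entry_w m : entry i w m = (if m == k then wk else 0) + entry k w' m * wk.
  case: (ltngtP m k) => [lt|lt|->].
  - by rewrite wlt // entry_out ?mul0r ?addr0 // ltnW.
  - by rewrite entry_w' // divfK // add0r.
  - by rewrite [entry k _ _]entry_out ?leqnn // mul0r addr0.
have entryN j d (u : 'cV[K]_d) m : entry j (- u) m = - entry j u m.
  rewrite /entry; case: ifP => _; last by rewrite oppr0.
  by case: insub => [p|]; rewrite ?mxE ?oppr0.
have entry_v'' m : entry i v' m = entry i v m - entry k w' m * entry i v k.
  case: (ltnP i m) => [lt_im|le_mi]; last first.
    by rewrite !(@entry_out _ _ _ _ m) ?mul0r ?subr0 //; lia.
  case: (ltnP m n) => [lt_mn|le_nm]; last first.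
    by rewrite !(@entry_out _ _ _ _ m) ?mul0r ?subr0 //; lia.
  have lt_p : (m - i.+1 < n - i.+1)%N by lia.
  have lt_q : (k - i.+1 < n - i.+1)%N by lia.
  have := entry_in i v' (Ordinal lt_p); rewrite /= subnKC // => ->.
  have := entry_in i v (Ordinal lt_p); rewrite /= subnKC // => ->.
  have := entry_in i v (Ordinal lt_q); rewrite /= subnKC // => ->.
  have -> : entry k w' m = - entry (k - i.+1) (- w') (m - i.+1).
    rewrite entryN opprK /entry.
    have -> : (m - i.+1 - (k - i.+1).+1 = m - k.+1)%N by lia.
    by have -> : (k - i.+1 < m - i.+1)%N = (k < m)%N by lia.
  rewrite mxE mulNr opprK.
  under eq_bigr => q _ do rewrite mxE LE mulrDl.
  rewrite big_split /=; congr (_ + _).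
    rewrite (bigD1 (Ordinal lt_p)) //= /delta eqxx mul1r big1 ?addr0 // => q.
    by rewrite -val_eqE eq_sym /= => /negPf ->; rewrite mul0r.
  rewrite (bigD1 (Ordinal lt_q)) //= /delta eqxx mulr1 big1 ?addr0 // => q.
  by rewrite -val_eqE eq_sym /= => /negPf ->; rewrite mulr0 mul0r.
(* v = L_k(w') v', the reason for L_i(v) L_k(w') = L_k(w') L_i(v'). *)
have entry_v' m : entry i v m = entry i v' m + entry k w' m * entry i v' k.
  rewrite !entry_v'' [entry k w' k]entry_out ?leqnn //; ring.
have entry_wbar m : entry i wbar m = if m == k then wk else 0.
  case: eqP => [->|/eqP mk].
    have lt_p : (k - i.+1 < n - i.+1)%N by lia.
    by have := entry_in i wbar (Ordinal lt_p); rewrite /= subnKC // mxE /= eqxx.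
  case: (ltnP i m) => [lt_im|?]; last by rewrite entry_out //; lia.
  case: (ltnP m n) => [lt_mn|?]; last by rewrite entry_out //; lia.
  have lt_p : (m - i.+1 < n - i.+1)%N by lia.
  have := entry_in i wbar (Ordinal lt_p); rewrite /= subnKC // mxE /= => ->.
  by case: eqP => //; lia.
have entryD m : entry i (v' + wbar) m = entry i v' m + entry i wbar m.
  rewrite /entry; case: ifP => _; last by rewrite addr0.
  by case: insub => [p|]; rewrite ?mxE ?addr0.
set S := imx_subst k 1 wk i.
have LS u : hact F (imx_L i wbar) u = hact F S u.
  apply: act_eq => r c; rewrite LE entry_wbar substE.
  by case: eqP => [->|_]; rewrite ?mul1r // mul0r addr0.
set L := imx_L k w'.
have rowL r c : L r c = delta K r c + entry k w' r * delta K k c by exact: LE.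
have rowLi c : L i c = delta K i c.
  by rewrite rowL entry_out ?mul0r ?addr0 // ltnW.
have intL u : hint F i (hact F L u) = hact F L (hint F i u).
  by apply: int_act => // r; rewrite rowL {2}/delta gtn_eqF // mulr0 addr0.
have LvarE (x : G) : hact F L (at_var x i) = at_var x i by exact: act_at_var.
have Lw u : hact F L (hact F (imx_L i w) u) = hact F S (hact F L u).
  rewrite !act_comp; apply: act_eq => r c.
  rewrite (@mul_row2 _ _ _ _ r i 1 (entry i w r)) => [|l].
  2: by rewrite LE mul1r.
  rewrite (@mul_row2 _ _ _ _ r k 1 (entry k w' r)) => [|l].
  2: by rewrite rowL mul1r.
  rewrite rowLi rowL !substE eqxx entry_w.
  by case: (eqVneq r k) => [->|_]; ring.
have Lv u : hact F L (hact F (imx_L i v) u) = hact F (imx_L i v') (hact F L u).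
  rewrite !act_comp; apply: act_eq => r c.
  rewrite (@mul_row2 _ _ _ _ r i 1 (entry i v r)) => [|l].
  2: by rewrite LE mul1r.
  rewrite (@mul_row2 _ _ _ _ r k 1 (entry k w' r)) => [|l].
  2: by rewrite rowL mul1r.
  by rewrite rowLi rowL !LE entry_v'; ring.
have LK u : hact F (imx_L k (- w')) (hact F L u) = u.
  rewrite act_comp; apply: act_id => r c.
  rewrite (@mul_row2 _ _ _ _ r k 1 (entry k w' r)) => [|l].
  2: by rewrite rowL mul1r.
  rewrite !LE !entryN [entry k w' k]entry_out ?leqnn //; ring.
(* Conjugate by L; the coefficients in x_i and the integral along x_i are
   unaffected. *)
rewrite -[LHS]LK -intL actM LvarE Lw -intL actM LvarE Lv.
have FLf : hcomp F n (hact F L f).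
  apply: comp_act Ff; apply: of_size_le (of_size_block _); lia.
set M := imx_L i v'; set f' := hact F L f in FLf *.
have rowM r c : M r c = delta K r c + entry i v' r * delta K i c by exact: LE.
have rowMi c : M i c = delta K i c.
  by rewrite rowM entry_out ?leqnn // mul0r addr0.
have colM r : M r k = delta K r k.
  by rewrite rowM {2}/delta (negPf ik) mulr0 addr0.
have szM : of_size n M by apply: of_size_le (of_size_block _); lia.
have rowa c : imx_row a 0 c =
    - (entry i v' k / wk) * delta K i c + wk^-1 * delta K k c
    - wk^-1 * delta K n c.
  rewrite /= /block_fun /=; case: ltnP => [lt_cn|le_nc]; last first.
    by rewrite /delta !ltn_eqF ?mulr0 ?addr0 ?subr0 //; lia.
  by rewrite mxE inordK // /delta !(eq_sym c).
have lt_ikn : (i < k < n)%N by rewrite lt_ik.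
rewrite (pull_coefficient _ e lt_ikn wk0 rowa szM (rowM k) rowMi FLf).
rewrite act_sum scaler_sumr; apply: eq_bigr => mu _; rewrite /chi'' /chi' /chi.
rewrite -actZ; congr (hact F _ _).
rewrite scalerAr; congr (_ * _).
set g' := at_var g i * _; set y := hint F k _.
have Ek (x : G) : hact F (imx_subst k 0 0 k) (at_var x i) = at_var x i.
  by apply: act_at_var => c; rewrite substE (negPf ik).
rewrite (int_triangular_int _ ik wk0 (rowM k) rowMi colM); last first.
  by rewrite actM !Ek.
rewrite -/S -/y LS; congr (_ *: (_ - hint F i _)).
have Sg : hact F S g' = g'.
  rewrite actM; congr (_ * _);
    by apply: act_at_var => c; rewrite substE (negPf ik).
rewrite actM Sg act_comp; congr (_ * _); apply: act_eq => r c.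
rewrite (@mul_row2 _ _ _ _ r i 1 (entry i v' r)) => [|l].
2: by rewrite rowM mul1r.
rewrite LE entryD entry_wbar !substE (negPf ik).
by case: (eqVneq r k) => [->|_]; ring.
Qed.
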